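(* For every SP-game $(R,B)$ there exists an invariant strong placement game (iSP-game) $(R',B')$ such that the game trees of $(R,B)$ and $(R',B')$ are isomorphic.
   Context: A board is a finite graph. A ruleset $R$ specifies which pieces each of the two players, Left and Right, may place (each piece occupies a non-empty collection of vertices of the board) and which placements are legal; $(R,B)$ denotes the game with ruleset $R$ played on board $B$. A position is a configuration of pieces on the board. A basic position is the board with exactly one piece placed. A position is legal if it can be reached from the empty board by a sequence of legal moves, and illegal otherwise. A strong placement game (SP-game) is a combinatorial game (two players, perfect information, no chance, no simultaneous moves) such that: (i) the board is empty at the beginning; (ii) players place pieces on empty spaces of the board according to the rules; (iii) pieces are not moved or removed once placed; (iv) if a position can be reached through a sequence of legal moves, then any sequence of moves leading to this position consists of legal moves. Hence a position is identified with the set of basic positions it is made of, and every subset of a legal position is legal. A board isomorphism between two boards (possibly already containing pieces) is a graph isomorphism such that a vertex contains a Left (respectively Right) piece if and only if its image does. The ruleset of an SP-game is invariant if: every basic position is legal; and the ruleset does not depend on the board, i.e. for any board isomorphism between boards $B_1$ and $B_2$, a move in $B_1$ is legal if and only if its isomorphic image in $B_2$ is legal. An SP-game with invariant ruleset is an invariant strong placement game (iSP-game). The game tree of a game is the rooted directed tree with edges labelled $L$ or $R$: the root is the empty board, the vertices correspond to positions (reached by moves of either player, in any order of players), and there is an edge $X\stackrel{L}{\rightarrow}Y$ (respectively $X\stackrel{R}{\rightarrow}Y$) for each legal move of Left (respectively Right) from $X$ to $Y$. Isomorphisms of game trees preserve the root and edge labels. *)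

(* Defs.v *)
From HB Require Import structures.
From mathcomp Require Import all_boot.

Set Implicit Arguments.
Unset Strict Implicit.
Unset Printing Implicit Defensive.

Inductive player := Left | Right.

Definition player_to_bool (p : player) : bool :=
  if p is Left then true else false.
Definition bool_to_player (b : bool) : player := if b then Left else Right.

Lemma player_to_boolK : cancel player_to_bool bool_to_player.
Proof. by case. Qed.

HB.instance Definition _ := Finite.copy player (can_type player_to_boolK).

Record board := Board {
  space :> finType;
  adj : rel space;
  adj_sym : symmetric adj;
  adj_irr : irreflexive adj }.

(* [(p, k, S)] is player [p] putting a piece of kind [k] on the vertices [S]. *)
Definition placement (K : finType) (B : board) : finType :=
  (player * K * {set B})%type.

Definition mover (K : finType) (B : board) (m : placement K B) : player :=
  m.1.1.
Definition kind (K : finType) (B : board) (m : placement K B) : K := m.1.2.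
Definition occupies (K : finType) (B : board) (m : placement K B) : {set B} :=
  m.2.

Definition position (K : finType) (B : board) : finType :=
  {set placement K B}.

(* [fits] says which pieces a player may place and which vertex sets such a   *)
(* piece can occupy; it sees the board only, not the pieces already placed.   *)
(* [permits X m] is the legality rule for the placement [m] in [X]. Keeping   *)
(* the two apart lets a single placed piece be an illegal position.           *)
Record ruleset := Ruleset {
  piece : finType;
  fits : forall B : board, pred (placement piece B);
  fits_neq0 : forall (B : board) (m : placement piece B),
    fits m -> occupies m != set0;
  permits : forall B : board, position piece B -> pred (placement piece B) }.

Section Game.
Variables (R : ruleset) (B : board).

Notation move := (placement (piece R) B).
Notation pos := (position (piece R) B).

Implicit Types (X : pos) (m : move) (s t : seq move).

Definition legal_move X m : bool := fits m && permits X m.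

Fixpoint legal_from X s : bool :=
  if s is m :: s' then legal_move X m && legal_from (m |: X) s' else true.

(* The players need not alternate. *)
Definition legal_play s : bool := legal_from set0 s.

Definition position_of s : pos := [set m in s].

Definition legal_position X : Prop :=
  exists2 s, legal_play s & position_of s = X.

Definition holds X (p : player) (v : B) : bool :=
  [exists m in X, (mover m == p) && (v \in occupies m)].

(* Starting from the empty board and never moving or removing a piece are     *)
(* built into [legal_play]. In the second clause [uniq t] is needed because   *)
(* [position_of] forgets that a sequence places the same piece twice.         *)
Definition SP_game : Prop :=
  (forall X m, legal_position X -> legal_move X m ->
     forall (v : B) (p : player), v \in occupies m -> ~~ holds X p v) /\
  (forall s t, legal_play s -> uniq t -> position_of t = position_of s ->
     legal_play t).

End Game.

(* Only the owner of the pieces on each vertex has to be preserved, not the   *)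
(* way in which the occupied vertices are grouped into pieces.                *)
Definition board_iso (R : ruleset) (B1 B2 : board)
    (X1 : position (piece R) B1) (X2 : position (piece R) B2)
    (f : B1 -> B2) : Prop :=
  [/\ bijective f,
      forall u v : B1, adj (f u) (f v) = adj u v
    & forall (p : player) (v : B1), holds X2 p (f v) = holds X1 p v].

Definition move_image (K : finType) (B1 B2 : board) (f : B1 -> B2)
    (m : placement K B1) : placement K B2 :=
  (mover m, kind m, f @: occupies m).

Definition invariant_ruleset (R : ruleset) : Prop :=
  (forall (B : board) (m : placement (piece R) B),
     fits m -> legal_position [set m]) /\
  (forall (B1 B2 : board)
     (X1 : position (piece R) B1) (X2 : position (piece R) B2)
     (f : B1 -> B2), board_iso X1 X2 f ->
     forall m : placement (piece R) B1,
       legal_move X1 m = legal_move X2 (move_image f m)).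

Definition iSP_game (R : ruleset) (B : board) : Prop :=
  SP_game R B /\ invariant_ruleset R.

Record LR_tree := LRTree {
  node : Type;
  root : node;
  edge : player -> node -> node -> Prop }.

Definition LR_tree_iso (T1 T2 : LR_tree) : Prop :=
  exists f : node T1 -> node T2,
    [/\ bijective f, f (root T1) = root T2
      & forall (p : player) (x y : node T1),
          edge p (f x) (f y) <-> edge p x y].

(* A node is a legal play from the empty board, so a position that can be     *)
(* reached in several move orders corresponds to several nodes.               *)
Definition game_tree (R : ruleset) (B : board) : LR_tree :=
  @LRTree {s : seq (placement (piece R) B) | legal_play s}
    (exist _ [::] isT)
    (fun p x y => exists2 m : placement (piece R) B,
       mover m = p & sval y = rcons (sval x) m).

(* Main.v *)
(** A legal play of an SP-game never repeats a placement, and whether a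
    repetition-free sequence of placements is legal depends only on its
    underlying set; so the game is determined by the family of legal sets of
    placements.  Take as new board a disjoint union of cliques of pairwise
    distinct sizes, one for each placement [k] of the old game, and let the new
    piece of kind [k] occupy the whole clique of [k].  Since that clique is the
    set of all vertices of a given degree, the rule can be phrased on every
    board in terms of vertex degrees and owners only, hence is invariant. *)

Require Import Defs.
From mathcomp Require Import all_boot.

Set Implicit Arguments.
Unset Strict Implicit.
Unset Printing Implicit Defensive.

(** * Legal plays of an SP-game as repetition-free orderings of legal sets *)

Section Play.
Variables (R : ruleset) (B : board).
Implicit Types (X : position (piece R) B) (m : placement (piece R) B).
Implicit Types (s : seq (placement (piece R) B)).

Lemma legal_from_rcons X s m :
  legal_from X (rcons s m) = legal_from X s && legal_move ([set x in s] :|: X) m.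
Proof.
elim: s X => [|a s IHs] X /=; first by rewrite andbT set_nil set0U.
by rewrite IHs andbA set_cons setUCA setUA.
Qed.

Lemma legal_play_rcons s m :
  legal_play (rcons s m) = legal_play s && legal_move (position_of s) m.
Proof. by rewrite /legal_play legal_from_rcons setU0. Qed.

Lemma position_of_rcons s m : position_of (rcons s m) = m |: position_of s.
Proof. by apply/setP=> x; rewrite !inE mem_rcons. Qed.

Lemma legal_play1 m : legal_play [:: m] = legal_move set0 m.
Proof. exact: andbT. Qed.

Hypothesis spRB : SP_game R B.

(** A piece occupies at least one vertex, and an earlier copy of it would already hold that
    vertex. *)
Lemma legal_move_notin X m : legal_position X -> legal_move X m -> m \notin X.
Proof.
move=> lX lm; have /set0Pn[v vm] : occupies m != set0.
  by case/andP: lm => /fits_neq0.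
apply: contra (spRB.1 X m lX lm v (mover m) vm) => mX.
by apply/existsP; exists m; rewrite mX eqxx.
Qed.

Lemma legal_play_uniq s : legal_play s -> uniq s.
Proof.
elim/last_ind: s => // s m IHs; rewrite legal_play_rcons rcons_uniq.
case/andP=> ls lm; rewrite IHs // andbT.
by have := legal_move_notin (ex_intro2 _ _ s ls erefl) lm; rewrite inE.
Qed.

(** By reordering, any repetition-free play may be compared with the canonical enumeration of its
    set; [clique_permits] tests legality in this form. *)
Lemma legal_playE s :
  legal_play s = uniq s && legal_play (enum (position_of s)).
Proof.
have eq_set : position_of (enum (position_of s)) = position_of s.
  by apply/setP=> x; rewrite inE mem_enum.
apply/idP/andP=> [ls | [us ls]]; last exact: spRB.2 ls us (esym eq_set).
by rewrite (legal_play_uniq ls) (spRB.2 _ _ ls (enum_uniq _) eq_set).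
Qed.

(** Moving [m] to the front is a reordering, so [m] is legal on the empty board. *)
Lemma legal_play_mem1 s m : legal_play s -> m \in s -> legal_play [:: m].
Proof.
move=> ls ms; have us := legal_play_uniq ls.
have: legal_play (m :: rem m s).
  apply: (spRB.2 _ _ ls); first by rewrite -(perm_uniq (perm_to_rem ms)).
  by apply/setP=> x; rewrite !inE (perm_mem (perm_to_rem ms)) inE.
by case/andP=> lm _; rewrite legal_play1.
Qed.

End Play.

(** * Degree classes under graph isomorphism *)

Definition degree_class (B : board) (n : nat) : {set B} :=
  [set v | #|adj v| == n].
Arguments degree_class : clear implicits.

Section Invariance.
Variables (B1 B2 : board) (f : B1 -> B2).
Hypotheses (bij_f : bijective f) (adj_f : forall u v, adj (f u) (f v) = adj u v).

Lemma card_adj_iso v : #|adj (f v)| = #|adj v|.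
Proof.
rewrite -(card_image (bij_inj bij_f)); apply: eq_card => y.
have [g fK gK] := bij_f.
rewrite -[y]gK mem_image; last exact: bij_inj bij_f.
by rewrite -!topredE /= adj_f.
Qed.

Lemma mem_degree_class_iso n v :
  (f v \in degree_class B2 n) = (v \in degree_class B1 n).
Proof. by rewrite !inE card_adj_iso. Qed.

Lemma degree_class_iso n : degree_class B2 n = f @: degree_class B1 n.
Proof.
have [g fK gK] := bij_f; apply/setP=> y.
by rewrite -[y]gK mem_degree_class_iso mem_imset //; apply: bij_inj bij_f.
Qed.

End Invariance.

(** * The new ruleset on an arbitrary board *)

Section CliqueGame.
Variables (R : ruleset) (B : board).

Local Notation old := (placement (piece R) B).
Implicit Types (k : old).

Section AnyBoard.
Variable C : board.
Implicit Types (X : position old C) (m : placement old C).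

Definition site k : {set C} := degree_class C (enum_rank k).

(** The last conjunct discards old placements that are illegal as first moves, so that every basic
    position is legal. *)
Definition clique_fits m : bool :=
  [&& occupies m != set0, occupies m == site (kind m),
      mover m == mover (kind m) & legal_play [:: kind m]].

Lemma clique_fits_neq0 m : clique_fits m -> occupies m != set0.
Proof. by case/andP. Qed.

(* The set of old placements is read off the owners of the vertices alone. *)
Definition decode X : {set old} :=
  [set k | (site k != set0) && [forall v in site k,
     [exists m in X, (mover m == mover k) && (v \in occupies m)]]].

(** Legality is always judged in the old game on [B], whatever the board [C]; the first conjunct
    forbids replaying a placement. *)
Definition clique_permits X m : bool :=
  (kind m \notin decode X) && legal_play (enum (kind m |: decode X)).

End AnyBoard.

Definition clique_ruleset : ruleset :=
  Ruleset clique_fits_neq0 clique_permits.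

Lemma mem_decode (C : board) (X : position old C) k :
  (k \in decode X) = (site C k != set0) &&
    [forall v in site C k, holds (R := clique_ruleset) X (mover k) v].
Proof. by rewrite inE. Qed.

(** The test [site k != set0] in [decode] is essential here: an empty site would satisfy the
    universal condition vacuously. *)
Lemma decode0 (C : board) : decode (set0 : position old C) = set0.
Proof.
apply/setP=> k; rewrite mem_decode inE; apply/negbTE/negP=> /andP[/set0Pn[v vk]].
move=> /forallP/(_ v); rewrite vk => /existsP[m].
by rewrite inE.
Qed.

Lemma clique_legal1 (C : board) (m : placement old C) :
  clique_fits m -> legal_position (R := clique_ruleset) [set m].
Proof.
move=> fm; exists [:: m]; last by apply/setP=> x; rewrite !inE.
rewrite legal_play1 /legal_move /= fm /clique_permits decode0 inE setU0.
by rewrite enum_set1; case/and4P: fm.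
Qed.

(** * Invariance of the new ruleset *)

Section Iso.
Variables (B1 B2 : board) (X1 : position old B1) (X2 : position old B2).
Variable f : B1 -> B2.
Hypothesis iso_f : board_iso (R := clique_ruleset) X1 X2 f.

Lemma site_iso k : site B2 k = f @: site B1 k.
Proof. by case: iso_f => bij_f adj_f _; apply: degree_class_iso. Qed.

Lemma decode_iso : decode X2 = decode X1.
Proof.
have [_ _ holds_f] := iso_f.
apply/setP=> k; rewrite !mem_decode {1}site_iso imset_eq0; congr (_ && _).
apply/forall_inP/forall_inP=> H v.
  by move=> vk; rewrite -holds_f H // site_iso imset_f.
by rewrite site_iso => /imsetP[u uk ->]; rewrite holds_f H.
Qed.

Lemma clique_legal_move_iso (m : placement old B1) :
  legal_move (R := clique_ruleset) X1 m =
  legal_move (R := clique_ruleset) X2 (move_image f m).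
Proof.
have [bij_f _ _] := iso_f.
rewrite /legal_move /= /clique_permits decode_iso; congr (_ && _).
rewrite /clique_fits site_iso imset_eq0 (inj_eq (imset_inj _)) //.
exact: bij_inj.
Qed.

End Iso.

Lemma clique_ruleset_invariant : invariant_ruleset clique_ruleset.
Proof.
split=> [C m | B1 B2 X1 X2 f iso_f m]; first exact: clique_legal1.
exact: clique_legal_move_iso.
Qed.

(** * The disjoint union of cliques *)

Definition clique_vertex : finType := {k : old & 'I_(enum_rank k).+1}.

Definition clique_adj : rel clique_vertex :=
  fun u v => (tag u == tag v) && (u != v).

Lemma clique_adj_sym : symmetric clique_adj.
Proof. by move=> u v; rewrite /clique_adj eq_sym (eq_sym u). Qed.

Lemma clique_adj_irr : irreflexive clique_adj.
Proof. by move=> u; rewrite /clique_adj !eqxx. Qed.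

Definition clique_board : board := Board clique_adj_sym clique_adj_irr.

Lemma card_clique k : #|[pred v : clique_vertex | k == tag v]| = (enum_rank k).+1.
Proof.
rewrite -[RHS]card_ord.
rewrite -(card_image (f := fun i => Tagged (fun k => 'I_(enum_rank k).+1) i)).
  apply: eq_card => -[k' i]; rewrite inE /=; apply/eqP/imageP=> [e | [j _ e]].
    by case: k' / e i => i; exists i.
  by have /= -> := congr1 tag e.
by move=> i j; apply: eq_from_Tagged.
Qed.

(** Adding [v] to its neighbours gives its whole clique. The successor in [clique_vertex] keeps
    cliques nonempty and makes the degree exactly the rank. *)
Lemma card_clique_adj (v : clique_vertex) : #|clique_adj v| = enum_rank (tag v).
Proof.
apply: succn_inj; rewrite -card_clique [RHS](cardD1 v) inE eqxx add1n; congr _.+1.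
by apply: eq_card => u; rewrite [LHS]andbC eq_sym !inE.
Qed.

Lemma mem_site k (v : clique_board) : (v \in site clique_board k) = (tag v == k).
Proof.
by rewrite inE card_clique_adj (inj_eq val_inj) (inj_eq enum_rank_inj).
Qed.

Lemma site_neq0 k : site clique_board k != set0.
Proof. by apply/set0Pn; exists (existT _ k ord0 : clique_vertex); rewrite mem_site. Qed.

(** * Translation of old placements and plays to the clique board *)

Definition encode k : placement old clique_board :=
  (mover k, k, site clique_board k).

Lemma encode_inj : injective encode.
Proof. by move=> k1 k2 []. Qed.

Lemma clique_fitsP (m : placement old clique_board) :
  clique_fits m -> m = encode (kind m).
Proof. by case: m => [[p k] S] /and4P[_ /eqP eS /eqP ep _]; rewrite /encode -eS -ep. Qed.

(** Cliques are disjoint, so only the piece of kind [tag v] can cover [v]. *)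
Lemma holds_encode (s : seq old) p (v : clique_board) :
  holds (R := clique_ruleset) (position_of (R := clique_ruleset) (map encode s))
    p v = (tag v \in s) && (mover (tag v) == p).
Proof.
apply/existsP/andP=> [[m] | [vs vp]].
  rewrite inE => /and3P[/mapP[k ks ->]] /= /eqP <-.
  by rewrite mem_site => /eqP ->.
by exists (encode (tag v)); rewrite inE map_f //= vp mem_site /=.
Qed.

Lemma decode_encode (s : seq old) :
  decode (position_of (R := clique_ruleset) (map encode s)) = [set k in s].
Proof.
apply/setP=> k; rewrite mem_decode site_neq0 inE /=.
apply/forall_inP/idP=> [H | ks v].
  have /set0Pn[v vk] := site_neq0 k.
  have := H v vk; rewrite holds_encode => /andP[ks _].
  by move: vk; rewrite mem_site => /eqP <-.
by rewrite mem_site holds_encode => /eqP ->; rewrite ks eqxx.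
Qed.

Hypothesis spRB : SP_game R B.

Lemma legal_move_encode (s : seq old) k : legal_play s ->
  legal_move (R := clique_ruleset)
    (position_of (R := clique_ruleset) (map encode s)) (encode k) =
  legal_move (position_of s) k.
Proof.
move=> ls.
have -> : legal_move (position_of s) k = legal_play (rcons s k).
  by rewrite legal_play_rcons ls.
rewrite /legal_move /= /clique_permits decode_encode inE /=.
rewrite /clique_fits /= site_neq0 !eqxx /=.
rewrite -[_ |: _]position_of_rcons (legal_playE spRB (rcons s k)).
rewrite rcons_uniq (legal_play_uniq spRB ls) andbT.
(* Both sides now test the set of [rcons s k]; the remaining condition, that [k] is legal as a first
   move, follows from that test. *)
apply: andb_idl => /andP[ks lsk]; apply: (legal_play_mem1 spRB lsk).
by rewrite mem_enum inE mem_rcons inE eqxx.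
Qed.

Lemma legal_play_encode (s : seq old) :
  legal_play (R := clique_ruleset) (map encode s) = legal_play s.
Proof.
elim/last_ind: s => // s k IHs.
rewrite map_rcons !legal_play_rcons IHs; apply: andb_id2l.
exact: legal_move_encode.
Qed.

(** Each move of a legal play fits, hence is the encoding of its kind; so [kind] inverts [encode] on
    legal plays. *)
Lemma clique_playE (t : seq (placement old clique_board)) :
  legal_play (R := clique_ruleset) t ->
  t = map encode (map (@kind _ _) t).
Proof.
elim/last_ind: t => // t m IHt; rewrite legal_play_rcons !map_rcons.
by case/and3P=> /IHt <- /clique_fitsP <-.
Qed.

Lemma clique_SP_game : SP_game clique_ruleset clique_board.
Proof.
split=> [_ m [t lt <-] lm v p vm | s t ls ut eq_st].
  move: lt lm; set s := map (@kind _ _) t => lt.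
  rewrite (clique_playE lt) -/s => /andP[/clique_fitsP em].
  rewrite /= /clique_permits decode_encode inE => /andP[ks _].
  (* A held vertex in the clique of [kind m] would mean that [kind m] was already played. *)
  move: vm; rewrite em mem_site holds_encode => /eqP ->.
  by rewrite (negbTE ks).
(* Every move of [t] occurs in [s], hence is an encoding; the reordering can then be pulled back to
   the old game. *)
have et : t = map encode (map (@kind _ _) t).
  rewrite -map_comp -[LHS]map_id; apply/eq_in_map=> m mt /=.
  have : m \in s by move/setP/(_ m): eq_st; rewrite !inE mt.
  by rewrite (clique_playE ls) => /mapP[k _ ->].
have es := clique_playE ls.
move: ls ut eq_st; rewrite {}es {}et (map_inj_uniq encode_inj).
rewrite !legal_play_encode => ls ut eq_st; apply: (spRB.2 _ _ ls ut).
apply/setP=> k; have /setP/(_ (encode k)) := eq_st.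
by rewrite !inE !(mem_map encode_inj).
Qed.

(** * Isomorphism of the game trees *)

Definition encode_play (x : node (game_tree R B)) :
  node (game_tree clique_ruleset clique_board) :=
  exist _ (map encode (sval x)) (etrans (legal_play_encode _) (svalP x)).

Lemma encode_play_bij : bijective encode_play.
Proof.
have lk (y : node (game_tree clique_ruleset clique_board)) :
    legal_play (map (@kind _ _) (sval y)).
  by rewrite -legal_play_encode -clique_playE; case: y.
exists (fun y => exist (fun s => legal_play s) _ (lk y)) => z; apply: val_inj => /=.
  by rewrite -map_comp map_id.
by rewrite -clique_playE //; case: z.
Qed.

Lemma clique_game_tree_iso :
  LR_tree_iso (game_tree R B) (game_tree clique_ruleset clique_board).
Proof.
exists encode_play; split; first exact: encode_play_bij.
  exact: val_inj.
move=> p x y; split=> -[m mp /= e]; last first.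
  by exists (encode m); rewrite //= e map_rcons.
(* The move along a new edge ends an encoded play, so it is itself an encoding. *)
have em : m = encode (kind m).
  have: m \in map encode (sval y) by rewrite e mem_rcons mem_head.
  by case/mapP=> k _ ->.
exists (kind m); first by rewrite -mp em.
by apply: (inj_map encode_inj); rewrite e map_rcons -em.
Qed.

End CliqueGame.

Theorem theorem2p17 (R : ruleset) (B : board) :
  SP_game R B ->
  exists (R' : ruleset) (B' : board),
    iSP_game R' B' /\ LR_tree_iso (game_tree R B) (game_tree R' B').
Proof.
move=> spRB; exists (clique_ruleset R B), (clique_board R B).
split; last exact: clique_game_tree_iso.
by split; [apply: clique_SP_game | apply: clique_ruleset_invariant].
Qed.
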